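(* Let $G_1$ and $G_2$ be non-trivial graphs. If the direct product $G_1\times G_2$ is hyperbolic, then one of the factor graphs is hyperbolic and the other one is bounded.
   Context: Conventions. A graph $G$ (such as $G_1,G_2$) is a nonempty, connected, simple (no loops, no multiple edges), possibly infinite graph; every edge has length $1$, and $G$ is regarded as a geodesic metric space by identifying each edge isometrically with $[0,1]$ and using the shortest-path distance $d_G$ (so points of $G$ are vertices and interior points of edges). A graph is trivial if it has exactly one vertex, and bounded if it has finite diameter. Direct product: $G_1\times G_2$ has vertex set $V(G_1)\times V(G_2)$, and $(u_1,v_1)$, $(u_2,v_2)$ are adjacent iff $[u_1,u_2]\in E(G_1)$ and $[v_1,v_2]\in E(G_2)$. It may be disconnected. Hyperbolicity: in a geodesic metric space $X$, a geodesic triangle is the union of three geodesics $[x_1x_2],[x_2x_3],[x_3x_1]$; it is $\delta$-thin if each side is contained in the $\delta$-neighborhood of the union of the other two sides. $\delta(T)$ is the infimum of $\delta\ge 0$ such that $T$ is $\delta$-thin, $\delta(X):=\sup_T\delta(T)$ over all geodesic triangles $T$ in $X$, and $X$ is hyperbolic if $\delta(X)<\infty$. If $X$ has connected components $X_i$, then $\delta(X):=\sup_i\delta(X_i)$, and $X$ is hyperbolic if $\delta(X)<\infty$. *)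

(* Defs.v *)
From Stdlib Require Import Relation_Operators.
From mathcomp Require Import all_boot all_order all_algebra.
From mathcomp Require Import all_classical all_reals all_analysis.

Set Implicit Arguments.
Unset Strict Implicit.
Unset Printing Implicit Defensive.

Import Order.TTheory GRing.Theory Num.Theory.
Local Open Scope classical_set_scope.
Local Open Scope ring_scope.

(* Hyperbolicity for a distance with values in the extended reals, where +oo
   is the distance between points of different components. *)
Section Hyperbolicity.
Variables (R : realType) (X : Type) (d : X -> X -> \bar R).

Definition geodesic (x y : X) (S : set X) : Prop :=
  exists (L : R) (g : R -> X),
    [/\ 0 <= L, g 0 = x, g L = y,
        forall s t, s \in `[0, L] -> t \in `[0, L] ->
          d (g s) (g t) = `|s - t|%:E
      & S = g @` `[0, L]].

Definition geodesic_triangle (S1 S2 S3 : set X) : Prop :=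
  exists x1 x2 x3,
    [/\ geodesic x1 x2 S1, geodesic x2 x3 S2 & geodesic x3 x1 S3].

(* Geodesics are compact, so it is immaterial whether the delta-neighborhood is
   defined by a point at distance at most delta or by an infimum. *)
Definition neighborhood (delta : R) (A : set X) : set X :=
  [set x | exists2 y, A y & (d x y <= delta%:E)%E].

Definition thin (delta : R) (S1 S2 S3 : set X) : Prop :=
  [/\ S1 `<=` neighborhood delta (S2 `|` S3),
      S2 `<=` neighborhood delta (S3 `|` S1)
    & S3 `<=` neighborhood delta (S1 `|` S2)].

Definition delta_triangle (S1 S2 S3 : set X) : \bar R :=
  ereal_inf [set delta%:E | delta in
    [set delta : R | 0 <= delta /\ thin delta S1 S2 S3]].

Definition delta_on (A : set X) : \bar R :=
  ereal_sup [set z | exists S1 S2 S3,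
    [/\ S1 `<=` A, S2 `<=` A, S3 `<=` A, geodesic_triangle S1 S2 S3
      & z = delta_triangle S1 S2 S3]].

Definition diameter : \bar R :=
  ereal_sup [set z | exists x y, z = d x y].

End Hyperbolicity.

Record graph : Type := Graph {
  vertex :> Type;
  adj : vertex -> vertex -> Prop;
  adj_sym : forall u v, adj u v -> adj v u;
  adj_irrefl : forall u, ~ adj u u
}.

Definition graph_connected (G : graph) : Prop :=
  forall u v : G, clos_refl_trans G (@adj G) u v.

Definition trivial_graph (G : graph) : Prop := exists! v : G, True.

Section DirectProduct.
Variables G1 G2 : graph.

Definition direct_adj (p q : G1 * G2) : Prop := adj p.1 q.1 /\ adj p.2 q.2.

Lemma direct_adj_sym p q : direct_adj p q -> direct_adj q p.
Proof. by case=> h1 h2; split; apply: adj_sym. Qed.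

Lemma direct_adj_irrefl p : ~ direct_adj p p.
Proof. by case=> /adj_irrefl. Qed.

Definition direct_product : graph := Graph direct_adj_sym direct_adj_irrefl.

End DirectProduct.

Section Realization.
Variables (R : realType) (G : graph).

(* A point of the metric graph is given by its barycentric coordinates, so that
   each edge is a copy of [0, 1] and edges meet exactly at common endpoints. *)
Definition vertex_point (u : G) : G -> R := \1_[set u].

Definition edge_point (u v : G) (t : R) : G -> R :=
  fun w => (1 - t) * \1_[set u] w + t * \1_[set v] w.

Definition realization : set (G -> R) :=
  [set x | (exists u, x = vertex_point u) \/
           (exists u v t, [/\ adj u v, 0 <= t <= 1 & x = edge_point u v t])].

(* [edge_path x y l]: some concatenation of segments, each contained in a
   closed edge, leads from x to y and has total length l. *)
Inductive edge_path : realization -> realization -> R -> Prop :=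
| edge_path_nil x : edge_path x x 0
| edge_path_cons x y z (u v : G) (s t l : R) :
    adj u v -> 0 <= s <= 1 -> 0 <= t <= 1 ->
    val x = edge_point u v s -> val y = edge_point u v t ->
    edge_path y z l -> edge_path x z (`|s - t| + l).

(* +oo if x and y are in different components *)
Definition graph_dist (x y : realization) : \bar R :=
  ereal_inf [set l%:E | l in edge_path x y].

Definition component (x : realization) : set realization :=
  [set y | exists l, edge_path x y l].

Definition delta_graph : \bar R :=
  ereal_sup (range (fun x => delta_on graph_dist (component x))).

Definition hyperbolic : Prop := (delta_graph < +oo)%E.

Definition bounded_graph : Prop := (diameter graph_dist < +oo)%E.

End Realization.

(* Main.v *)
(* A geodesic u_0, u_1, ... of one factor lifts to the geodesic
   (u_0, v_0), (u_1, v_1), (u_2, v_0), ... of the product along an edge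
   [v_0, v_1] of the other one, since both projections are 1-Lipschitz.  So a
   closed triangle of even perimeter lifts to a closed triangle.  If the
   perimeter is odd, going around twice gives a geodesic hexagon.  It is thin,
   and a point p of a side [xy] is then close to the lift of another side, as
   wanted, or to the second lift of [xy], hence to the second lift of p.  In the
   latter case the path from p around the triangle to its second lift is closed
   up by a short segment into a thin pentagon, and a point of [py] at suitable
   distance from p can only be close to the lifts of [yz] and [zx].  Therefore
   both factors are hyperbolic.

   If both factors contain geodesics u_0 ... u_2n and v_0 ... v_2n, then
   (u_0, v_n), (u_n, v_2n), (u_2n, v_n), (u_n, v_0) have consecutive distances n
   and opposite distances 2n, which is impossible for large n.

   Thinness is handled through the condition [fellow], which only involves
   distances between vertices: a point p with d(x,p) + d(p,y) = d(x,y) satisfies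
   d(x,p) + d(p,z) <= d(x,z) + c or d(z,p) + d(p,y) <= d(z,y) + c. *)

Require Import Defs.
From mathcomp Require Import all_boot all_order all_algebra.
From mathcomp Require Import all_classical all_reals all_analysis.
From mathcomp Require Import zify ring lra.

Set Implicit Arguments.
Unset Strict Implicit.
Unset Printing Implicit Defensive.

(** * Walks, the combinatorial distance, and the condition [fellow] for polygons *)

Fixpoint walk (G : graph) n (u v : G) : Prop :=
  if n is m.+1 then exists2 w, adj u w & walk m w v else u = v.

Definition linked (G : graph) (u v : G) := exists n, walk n u v.

(** The value is the default [0] on unlinked pairs; this matters since the direct product may be
    disconnected. *)
Definition dist (G : graph) (u v : G) : nat :=
  xget 0 [set n | walk n u v /\ forall m, walk m u v -> n <= m]%classic.

Section Walks.
Variable G : graph.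
Implicit Types u v w x y z p : G.

Lemma walk_cat m n u v w : walk m u v -> walk n v w -> walk (m + n) u w.
Proof.
elim: m u => [|m IH] u /= => [-> //|[x ux xv] vw].
by exists x => //; apply: IH.
Qed.

Lemma walk_adj u v : adj u v -> walk 1 u v.
Proof. by exists v. Qed.

Lemma walk_sym n u v : walk n u v -> walk n v u.
Proof.
elim: n u => [|n IH] u; first by move=> /= ->.
case=> w uw /IH wv; rewrite -addn1.
by apply: walk_cat wv (walk_adj (adj_sym uw)).
Qed.

Lemma walk_split m n u v :
  walk (m + n) u v -> exists2 w, walk m u w & walk n w v.
Proof.
elim: m u => [|m IH] u /= => [uv|[w uw /IH[x wx xv]]]; first by exists u.
by exists x => //; exists w.
Qed.

Lemma linked_refl u : linked u u. Proof. by exists 0. Qed.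

Lemma linked_sym u v : linked u v -> linked v u.
Proof. by case=> n /walk_sym; exists n. Qed.

Lemma linked_trans v u w : linked u v -> linked v w -> linked u w.
Proof. by case=> m uv [n vw]; exists (m + n); apply: walk_cat uv vw. Qed.

Lemma distP u v : linked u v ->
  walk (dist u v) u v /\ forall m, walk m u v -> dist u v <= m.
Proof.
move=> uv; apply: (@xgetPex _ 0 [set n | walk n u v /\ _]%classic).
have {uv}: exists n, `[< walk n u v >] by case: uv => n /asboolP; exists n.
by case/ex_minnP => n /asboolP nuv min_n; exists n; split => // m /asboolP/min_n.
Qed.

Lemma walk_dist u v : linked u v -> walk (dist u v) u v.
Proof. by case/distP. Qed.

Lemma dist_le n u v : walk n u v -> dist u v <= n.
Proof. by move=> w; have [_ ->] := @distP u v (ex_intro _ n w). Qed.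

Lemma dist_refl u : dist u u = 0.
Proof. by apply/eqP; rewrite -leqn0 dist_le. Qed.

Lemma dist_sym u v : linked u v -> dist u v = dist v u.
Proof.
move=> uv; apply/eqP; rewrite eqn_leq !dist_le //; apply: walk_sym.
  exact: walk_dist.
exact/walk_dist/linked_sym.
Qed.

Lemma dist_trans v u w :
  linked u v -> linked v w -> dist u w <= dist u v + dist v w.
Proof. by move=> uv vw; apply: dist_le; apply: walk_cat; apply: walk_dist. Qed.

Lemma dist_split m u v : linked u v -> m <= dist u v -> exists w,
  [/\ linked u w, linked w v, dist u w = m & dist w v = dist u v - m].
Proof.
move=> uv lem; have := walk_dist uv; rewrite -{1}(subnKC lem).
case/walk_split => w uw wv.
have luw : linked u w by exists m.
have lwv : linked w v by exists (dist u v - m).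
exists w; split=> //.
  by have := dist_le uw; have := dist_le wv; have := dist_trans luw lwv; lia.
by have := dist_le uw; have := dist_le wv; have := dist_trans luw lwv; lia.
Qed.

Definition btw c x p y := dist x p + dist p y <= dist x y + c.

Definition fellow c := forall x y z p, linked x p -> linked p y -> linked p z ->
  btw 0 x p y -> btw c x p z \/ btw c z p y.

(** A point [q] on a geodesic from [x] to [y], level with [p], is within [c + e] of [p] by [fellow]
    for [x], [y], [p]. Applying [fellow] to [q] and [z] and moving from [q] back to [p] costs
    [c + 2 * (c + e)]. *)
Lemma fellow_slack c e x y z p : fellow c ->
  linked x p -> linked p y -> linked p z -> btw e x p y ->
  btw (3 * c + 2 * e) x p z \/ btw (3 * c + 2 * e) z p y.
Proof.
rewrite /btw => fc xp py pz xpy.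
have xy := linked_trans xp py.
have [q [xq qy dxq dqy]] := @dist_split (minn (dist x p) (dist x y)) x y xy
  (geq_minr _ _).
have qp := linked_trans (linked_sym xq) xp.
have qz := linked_trans qp pz.
have qb : btw 0 x q y by rewrite /btw; lia.
have Spq := dist_sym qp; have Sqz := dist_sym qz; have Spz := dist_sym pz.
(* If [p] is farther from [x] than [y] is, the minimum makes [q] equal to [y], and [p] is within [e]
   of it. *)
have close : dist p q <= c + e.
  case: (leqP (dist x p) (dist x y)) => le_xp; last first.
    have /walk_dist : linked q y := qy.
    have -> /= : dist q y = 0 by lia.
    by move=> ->; lia.
  have [] := fc x y p q xq qy qp qb; rewrite /btw; first lia.
  lia.
have T1 := dist_trans xq qp; have T2 := dist_trans (linked_sym qp) qz.
have T3 := dist_trans xp (linked_sym qp); have T4 := dist_trans (linked_sym qp) qy.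
have T5 := dist_trans (linked_sym qz) qp.
by have [] := fc x y z q xq qy qz qb; rewrite /btw; [left|right]; lia.
Qed.

Fixpoint linked_path x s :=
  if s is w :: s' then linked x w /\ linked_path w s' else True.

Fixpoint btw_side c x s p :=
  if s is w :: s' then btw c x p w \/ btw_side c w s' p else False.

Lemma btw_side_mono c c' x s p : c <= c' -> btw_side c x s p -> btw_side c' x s p.
Proof.
by move=> cc'; elim: s x => //= w s IH x [|/IH]; rewrite /btw; [left; lia|right].
Qed.

(** Induction cutting off the triangle formed by [x], [w] and the last vertex. The diagonal inherits
    slack [3 * c + 2 * e], so the quantity [e + 3 * c] doubles at each cut. *)
Lemma fellow_polygon c e x w s p : fellow c -> linked x p ->
  linked_path x (w :: s) -> btw e x p (last w s) ->
  btw_side (2 ^ size s * (e + 3 * c)) x (w :: s) p.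
Proof.
move=> fc; elim: s e x w => [|v s IH] e x w xp /= [xw lws] xpl.
  by left; move: xpl; rewrite /btw; lia.
have wp := linked_trans (linked_sym xw) xp.
have ll : linked w (last v s).
  elim: (s) (v) (w) lws => [|v' s' IHs] v1 w1 /=; first by case.
  by case=> w1v1 H; apply: linked_trans w1v1 (IHs _ _ H).
have pl := linked_trans (linked_sym wp) ll.
have [] := fellow_slack fc xp pl (linked_sym wp) xpl => [H|H]; [left|right].
  move: H; rewrite /btw => H; apply: leq_trans H _; rewrite leq_add2l expnS.
  have : 0 < 2 ^ size s by rewrite expn_gt0.
  by nia.
apply: btw_side_mono (IH _ w v wp lws H).
by rewrite expnS; nia.
Qed.

End Walks.

Section Connected.
Variables (G : graph) (conn : graph_connected G).

Lemma graph_linked (u v : G) : linked u v.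
Proof.
elim: (conn u v) => [x y /walk_adj|x|x y z _ xy _]; first by exists 1.
  exact: linked_refl.
exact: linked_trans xy.
Qed.

Lemma graph_edge : inhabited G -> ~ trivial_graph G -> exists u v : G, adj u v.
Proof.
case=> u nontriv; have [v uv] : exists v, u <> v.
  by apply: contrapT => /forallNP E; apply: nontriv; exists u; split=> // v _;
     apply: contrapT => /E.
by have [[|n] /=] := graph_linked u v => // -[w uw _]; exists u, w.
Qed.

End Connected.

(** * Lifting geodesics to the product and descent of [fellow] to a factor *)

(* [H] stands for the product of [G] with a graph that has an edge [v_0, v_1],
   and [lift b] for the embedding [u |-> (u, v_b)]. *)
Section Lifting.
Variables (H G : graph) (pr : H -> G) (lift : bool -> G -> H).
Hypothesis pr_adj : forall a b, adj a b -> adj (pr a) (pr b).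
Hypothesis lift_adj : forall b u v, adj u v -> adj (lift b u) (lift (~~ b) v).
Hypothesis liftK : forall b, cancel (lift b) pr.
Hypothesis conn : graph_connected G.

Lemma walk_pr n a b : walk n a b -> walk n (pr a) (pr b).
Proof.
elim: n a => [|n IH] a /= => [-> //|[w /pr_adj aw /IH wb]].
by exists (pr w).
Qed.

Lemma dist_pr a b : linked a b -> dist (pr a) (pr b) <= dist a b.
Proof. by move=> ab; apply/dist_le/walk_pr/walk_dist. Qed.

Lemma walk_lift n b u v : walk n u v -> walk n (lift b u) (lift (b (+) odd n) v).
Proof.
elim: n b u => [|n IH] b u /= => [->|[w uw wv]]; first by rewrite addbF.
exists (lift (~~ b) w); first exact: lift_adj.
by rewrite addbN -addNb; apply: IH.
Qed.

(** The lifted geodesic bounds the distance from above, the projection from below; the parity of the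
    length decides on which copy the lift ends. *)
Lemma dist_lift b c u v : c = b (+) odd (dist u v) ->
  linked (lift b u) (lift c v) /\ dist (lift b u) (lift c v) = dist u v.
Proof.
move=> ->; have W := walk_lift b (walk_dist (graph_linked conn u v)).
have L : linked (lift b u) (lift (b (+) odd (dist u v)) v).
  by exists (dist u v).
split=> //; apply/eqP; rewrite eqn_leq dist_le //=.
by have := dist_pr L; rewrite !liftK.
Qed.

Lemma btw_pr c a p b : linked a p -> linked p b ->
  dist a b = dist (pr a) (pr b) -> btw c a p b -> btw c (pr a) (pr p) (pr b).
Proof.
by move=> ap pb dab; rewrite /btw; have := dist_pr ap; have := dist_pr pb; lia.
Qed.

Lemma fellow_lift c : fellow H c -> fellow G (170 * c + 2).
Proof.
move=> fH x y z p xp py pz xpy.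
have gl := graph_linked conn.
have Exy : dist x y = dist x p + dist p y.
  by have := dist_trans xp py; rewrite /btw in xpy; lia.
have dS u v : dist u v = dist v u := dist_sym (gl u v).
(* These bits record the copy reached along a lift that starts at [x] on copy [false]; [bx] is the
   parity of the perimeter. *)
pose bp := odd (dist x p); pose by_ := odd (dist x y).
pose bz := by_ (+) odd (dist y z); pose bx := bz (+) odd (dist z x).
have Eby : by_ = bp (+) odd (dist p y) by rewrite /by_ Exy oddD.
have [xp0 Dxp0] := @dist_lift false bp x p erefl.
have [py0 Dpy0] := dist_lift Eby.
have [yz0 Dyz0] := @dist_lift by_ bz y z erefl.
have [zx0 Dzx0] := @dist_lift bz bx z x erefl.
have [xp1 Dxp1] := @dist_lift bx (bx (+) bp) x p erefl.
have Eby1 : bx (+) by_ = bx (+) bp (+) odd (dist p y) by rewrite Eby addbA.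
have [py1 Dpy1] := dist_lift Eby1.
have [xy1 Dxy1] := @dist_lift bx (bx (+) by_) x y erefl.
have [yz1 Dyz1] := @dist_lift (bx (+) by_) (bx (+) bz) y z (addbA _ _ _).
(* Twice the perimeter is even, so the second turn ends on the copy where the first one began. *)
have Ebx1 : false = bx (+) bz (+) odd (dist z x).
  by rewrite /bx; case: (bz); case: (odd _).
have [zx1 Dzx1] := dist_lift Ebx1.
have [_ Dxy0] := @dist_lift false by_ x y erefl.
(* Going twice around the triangle meets the lifts x0, p0, y0, z0, x1, p1, y1,
   z1, and then x0 again. *)
clearbody bx; clearbody bz; clearbody by_; clearbody bp.
set x0 := lift false x in xp0 Dxp0 zx1 Dzx1 Dxy0.
set p0 := lift bp p in xp0 Dxp0 py0 Dpy0.
set y0 := lift by_ y in py0 Dpy0 yz0 Dyz0 Dxy0.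
set z0 := lift bz z in yz0 Dyz0 zx0 Dzx0.
set x1 := lift bx x in zx0 Dzx0 xp1 Dxp1 xy1 Dxy1.
set p1 := lift _ p in xp1 Dxp1 py1 Dpy1.
set y1 := lift _ y in py1 Dpy1 xy1 Dxy1 yz1 Dyz1.
set z1 := lift _ z in yz1 Dyz1 zx1 Dzx1.
have lp0 := linked_sym xp0.
have lpy : linked p0 y0 by [].
have lpz := linked_trans lpy yz0.
have lpx1 := linked_trans lpz zx0.
have lpy1 := linked_trans lpx1 xy1.
have lpz1 := linked_trans lpy1 yz1.
(* The side from [x0] to [y0] through [p0] is compared with the other five sides, traversed
   backwards; five sides need four cuts, whence [2 ^ 4 * (3 * c)]. *)
have hexagon : btw_side (48 * c) x0 [:: z1; y1; x1; z0; y0] p0.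
  have -> : 48 * c = 2 ^ 4 * (0 + 3 * c) by lia.
  apply: (@fellow_polygon H c 0 x0 z1 [:: y1; x1; z0; y0]) => //=.
    by do !split; apply: linked_sym.
  by rewrite /btw; lia.
have prE b u : pr (lift b u) = u by rewrite liftK.
have proj k u v a b : linked a p0 -> linked p0 b -> pr a = u -> pr b = v ->
    dist a b = dist u v -> btw k a p0 b -> btw k u p v.
  by move=> ap pb <- <- dab /(btw_pr ap pb dab); rewrite prE.
have weak k k' u v : k <= k' -> btw k u p v -> btw k' u p v by rewrite /btw; lia.
have le48 : 48 * c <= 170 * c + 2 by lia.
have z1p := linked_sym lpz1; have y1p := linked_sym lpy1.
have x1p := linked_sym lpx1; have z0p := linked_sym lpz.
(* Four of the sides lie over [[yz]] or [[zx]] and project to the claim; only the second lift of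
   [[xy]] needs more work. *)
case: hexagon => [b|[b|[b|[b|[b|//]]]]].
- left; apply: (weak _ _ _ _ le48); apply: (proj _ _ _ x0 z1) b; rewrite ?prE //.
  by rewrite dS -Dzx1 dist_sym //; apply: linked_sym.
- right; apply: (weak _ _ _ _ le48); apply: (proj _ _ _ z1 y1) b; rewrite ?prE //.
  by rewrite dS -Dyz1 dist_sym //; apply: linked_sym.
- have close : dist p0 p1 <= 49 * c.
    have lpp1 := linked_trans lpx1 xp1.
    have p1E : btw 0 x1 p1 y1 by rewrite /btw; lia.
    have := fH x1 y1 p0 p1 xp1 py1 (linked_sym lpp1) p1E.
    have := dist_pr x1p; have := dist_pr lpy1; have := dist_sym lpp1.
    have := dist_sym x1p; have := dist_sym lpy1; have := dist_sym xy1.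
    by move: b; rewrite /btw !prE; lia.
  have [s Es] : exists s, s = 73 * c + 1 by exists (73 * c + 1).
  case: (leqP s (dist p y)) => [le_s|lt_s]; last first.
    by right; rewrite /btw; have := dist_trans (gl z p) (gl p y);
       have := dist_trans (gl z y) (gl y p); rewrite (dS y p); lia.
  have [q [pq qy dpq dqy]] := dist_split py le_s.
  have Eq : bp (+) odd s = bp (+) odd (dist p q) by rewrite dpq.
  have [pq0 Dpq0] := dist_lift Eq.
  have Eqy : by_ = bp (+) odd s (+) odd (dist q y).
    by rewrite Eby -addbA -oddD dqy subnKC.
  have [qy0 Dqy0] := dist_lift Eqy.
  rewrite -/p0 in pq0 Dpq0; rewrite -/y0 in qy0 Dqy0.
  set q0 := lift (bp (+) odd s) q in pq0 Dpq0 qy0 Dqy0.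
  have qz0 := linked_trans qy0 yz0; have qx1 := linked_trans qz0 zx0.
  have qp1 := linked_trans qx1 xp1.
  have pentagon : btw_side (24 * c) p0 [:: p1; x1; z0; y0] q0.
    have -> : 24 * c = 2 ^ 3 * (0 + 3 * c) by lia.
    apply: (@fellow_polygon H c 0 p0 p1 [:: x1; z0; y0]) => //=.
      split; first exact: linked_trans lpx1 xp1.
      by do !split; apply: linked_sym.
    by rewrite /btw; lia.
  have far k u v : btw k u q v -> btw (k + 2 * s) u p v.
    rewrite /btw; have := dist_trans (gl u q) (gl q p).
    by have := dist_trans (gl p q) (gl q v); rewrite (dS q p); lia.
  have le24 : 24 * c + 2 * s <= 170 * c + 2 by lia.
  case: pentagon => [b'|[b'|[b'|[b'|//]]]].
  + by move: b'; rewrite /btw; lia.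
  + move: b'; rewrite /btw.
    have := dist_pr qx1; have := dist_trans xp pq; have := dist_trans (gl x q) qy.
    have := dist_sym xp1; have := dist_sym qx1; have := dist_pr (linked_sym qp1).
    by rewrite !prE (dS q x); lia.
  + left; apply: (weak _ _ _ _ le24); apply: far.
    have := btw_pr (linked_sym qx1) qz0 _ b'.
    by rewrite !prE; apply; rewrite dS -Dzx0 dist_sym //; apply: linked_sym.
  + right; apply: (weak _ _ _ _ le24); apply: far.
    have := btw_pr (linked_sym qz0) qy0 _ b'.
    by rewrite !prE; apply; rewrite dS -Dyz0 dist_sym //; apply: linked_sym.
- left; apply: (weak _ _ _ _ le48); apply: (proj _ _ _ x1 z0) b; rewrite ?prE //.
  by rewrite dS -Dzx0 dist_sym //; apply: linked_sym.
- right; apply: (weak _ _ _ _ le48); apply: (proj _ _ _ z0 y0) b; rewrite ?prE //.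
  by rewrite dS -Dyz0 dist_sym //; apply: linked_sym.
Qed.

End Lifting.

Section Product.
Variables G1 G2 : graph.
Hypotheses (conn1 : graph_connected G1) (conn2 : graph_connected G2).

Lemma walk_product n (a b : direct_product G1 G2) :
  walk n a.1 b.1 -> walk n a.2 b.2 -> walk n a b.
Proof.
elim: n a => [|n IH] [a1 a2] /=; first by case: b => b1 b2 /= -> ->.
case=> w1 aw1 wb1 [w2 aw2 wb2]; exists (w1, w2); first by split.
exact: IH.
Qed.

Lemma dist_product (a b : direct_product G1 G2) : linked a b ->
  dist a.1 b.1 <= dist a b /\ dist a.2 b.2 <= dist a b.
Proof.
move=> ab; split.
  by apply: (@dist_pr _ _ (fun a : direct_product G1 G2 => a.1) _ _ _ ab) => ? ? [].
by apply: (@dist_pr _ _ (fun a : direct_product G1 G2 => a.2) _ _ _ ab) => ? ? [].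
Qed.

Lemma product_fellow_bounded c : fellow (direct_product G1 G2) c ->
  (forall u v : G1, dist u v < 2 * c + 2) \/
  (forall u v : G2, dist u v < 2 * c + 2).
Proof.
have midpoint (G : graph) (conn : graph_connected G) (u v : G) n :
    2 * n <= dist u v ->
    exists m w, [/\ walk n u m, walk n m w & dist u w = 2 * n].
  case/(dist_split (graph_linked conn u v)) => w [_ _ uw _].
  have /(dist_split (graph_linked conn u w)) [m [um mw umE mwE]] : n <= dist u w.
    by lia.
  exists m, w; split=> //; first by rewrite -umE; apply: walk_dist.
  have nE : n = dist m w by lia.
  by rewrite nE; apply: walk_dist.
move=> fP; set P := forall u v : G1, _; have [/asboolP|/asboolPn] := boolP `[<P>].
  by left.
case/existsNP => u0 /existsNP[u2' /negP]; rewrite -leqNgt => u02.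
right => v0 v2'; rewrite ltnNge; apply/negP => v02.
have [|u1 [u2 [u01 u12 u02E]]] := midpoint G1 conn1 u0 u2' c.+1; first lia.
have [|v1 [v2 [v01 v12 v02E]]] := midpoint G2 conn2 v0 v2' c.+1; first lia.
have W n (a b : direct_product G1 G2) : walk n a.1 b.1 -> walk n a.2 b.2 ->
    linked a b /\ dist a b <= n.
  by move=> wa wb; have w := walk_product wa wb; split; [exists n|apply: dist_le].
have [xp dxp] := W c.+1 (u0, v1) (u1, v2) u01 v12.
have [py dpy] := W c.+1 (u1, v2) (u2, v1) u12 (walk_sym v12).
have [xz dxz] := W c.+1 (u0, v1) (u1, v0) u01 (walk_sym v01).
have [zy dzy] := W c.+1 (u1, v0) (u2, v1) u12 v01.
have pz := linked_trans (linked_sym xp) xz.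
have [/= dxy _] := dist_product (linked_trans xp py).
have [/= _ dpz] := dist_product (linked_sym pz).
have := dist_trans xp py; have := dist_sym pz => dzp dxy'.
have := fP (u0, v1) (u2, v1) (u1, v0) (u1, v2) xp py pz.
by rewrite /btw; lia.
Qed.

End Product.

Import Order.TTheory GRing.Theory Num.Theory.
Local Open Scope classical_set_scope.
Local Open Scope ring_scope.

Section Realization.
Variables (R : realType) (G : graph).
Local Notation point := (set_type (@realization R G)).
Implicit Types (u v a b p : G) (x y z q : point).

Lemma vertex_point_subproof u : vertex_point R u \in @realization R G.
Proof. by apply/mem_set; left; exists u. Qed.

Definition vpt u : point :=
  exist (fun x : G -> R => x \in @realization R G) _ (vertex_point_subproof u).

Lemma edge_point0 u v : edge_point u v 0 = vertex_point R u.
Proof. by apply/funext => w; rewrite /edge_point subr0 mul1r mul0r addr0. Qed.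

Lemma edge_point1 u v : edge_point u v 1 = vertex_point R v.
Proof. by apply/funext => w; rewrite /edge_point subrr mul1r mul0r add0r. Qed.

Definition ept u v (t : R) : point := insubd (vpt u) (edge_point u v t).

Lemma val_ept u v t : adj u v -> 0 <= t <= 1 -> val (ept u v t) = edge_point u v t.
Proof.
move=> uv t01; rewrite val_insubd ifT //.
by apply/mem_set; right; exists u, v, t.
Qed.

Lemma edge_path_seg u v (s t : R) x y : adj u v -> 0 <= s <= 1 -> 0 <= t <= 1 ->
  val x = edge_point u v s -> val y = edge_point u v t -> edge_path x y `|s - t|.
Proof.
move=> uv s01 t01 xE yE; rewrite -[`|_|]addr0.
exact: edge_path_cons uv s01 t01 xE yE (edge_path_nil _).
Qed.

Lemma edge_path_cat x y z l m :
  edge_path x y l -> edge_path y z m -> edge_path x z (l + m).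
Proof.
elim=> [w|a b c u v s t k uv s01 t01 aE bE _ IH] yz; first by rewrite add0r.
by rewrite -addrA; apply: edge_path_cons uv s01 t01 aE bE (IH yz).
Qed.

Lemma edge_path_sym x y l : edge_path x y l -> edge_path y x l.
Proof.
elim=> [w|a b c u v s t k uv s01 t01 aE bE _ IH]; first exact: edge_path_nil.
by rewrite addrC; apply: edge_path_cat IH _; rewrite distrC;
   apply: edge_path_seg uv t01 s01 bE aE.
Qed.

Lemma edge_path_ge0 x y l : edge_path x y l -> 0 <= l.
Proof. by elim=> // *; apply: addr_ge0. Qed.

Definition joined x y := exists l, edge_path x y l.

Lemma joined_sym x y : joined x y -> joined y x.
Proof. by case=> l /edge_path_sym; exists l. Qed.

Lemma joined_trans y x z : joined x y -> joined y z -> joined x z.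
Proof. by case=> l xy [m /(edge_path_cat xy)]; exists (l + m). Qed.

Definition gdist x y : R := fine (graph_dist x y).

Lemma graph_dist_ge0 x y : (0 <= graph_dist x y)%E.
Proof.
by apply: le_ereal_inf_tmp => _ [l /edge_path_ge0 l0 <-]; rewrite lee_fin.
Qed.

Lemma graph_distE x y : joined x y -> graph_dist x y = (gdist x y)%:E.
Proof.
case=> l xy; rewrite /gdist fineK // ge0_fin_numE ?graph_dist_ge0 //.
by apply: le_lt_trans (ltry l); apply: ereal_inf_lbound; exists l.
Qed.

Lemma graph_dist_joined x y r : graph_dist x y = r%:E -> joined x y.
Proof.
move=> xyr; apply: contrapT => nxy.
suff: graph_dist x y = +oo%E by rewrite xyr.
by rewrite /graph_dist (_ : [set _ | _ in _] = set0) ?ereal_inf0 //;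
   apply/seteqP; split => // t [l xy _]; apply: nxy; exists l.
Qed.

Lemma gdist_ge0 x y : 0 <= gdist x y.
Proof. by rewrite fine_ge0 ?graph_dist_ge0. Qed.

Lemma gdist_le x y l : edge_path x y l -> gdist x y <= l.
Proof.
move=> xy; rewrite -lee_fin -graph_distE; last by exists l.
by apply: ereal_inf_lbound; exists l.
Qed.

Lemma gdist_lt x y r : joined x y -> gdist x y < r ->
  exists2 l, edge_path x y l & l < r.
Proof.
move=> xy; rewrite -lte_fin -graph_distE // => /ereal_inf_lt[_ [l xyl <-]].
by rewrite lte_fin; exists l.
Qed.

Lemma gdist_sym x y : gdist x y = gdist y x.
Proof.
by rewrite /gdist /graph_dist; congr (fine (ereal_inf _)); apply/seteqP;
   split=> _ [l /edge_path_sym xy <-]; exists l.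
Qed.

Lemma gdist_trans y x z : joined x y -> joined y z ->
  gdist x z <= gdist x y + gdist y z.
Proof.
move=> xy yz; apply/ler_addgt0Pr => e e0.
have [|l xyl le1] := @gdist_lt x y (gdist x y + e / 2) xy; first lra.
have [|m yzm le2] := @gdist_lt y z (gdist y z + e / 2) yz; first lra.
by apply: le_trans (gdist_le (edge_path_cat xyl yzm)) _; lra.
Qed.

(* The affine interpolation of [f] along the edges is well defined on points. *)
Lemma edge_point_interp (f : G -> R) u v u' v' (s t : R) :
  edge_point u v s = edge_point u' v' t ->
  (1 - s) * f u + s * f v = (1 - t) * f u' + t * f v'.
Proof.
pose r : seq {classic G} := undup ([:: u; v; u'; v'] : seq {classic G}).
have ind (a : {classic G}) :
    a \in r -> \sum_(w <- r) \1_[set (a : G)] w * f w = f a.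
  move=> ar; rewrite (bigD1_seq a) ?undup_uniq //= indicE mem_set // mul1r.
  rewrite big1 ?addr0 // => w /eqP wa; rewrite indicE memNset ?mul0r //.
have lin (a b : {classic G}) (c : R) : a \in r -> b \in r ->
    \sum_(w <- r) edge_point (a : G) b c w * f w = (1 - c) * f a + c * f b.
  move=> ar br; rewrite -(ind a ar) -(ind b br) !mulr_sumr -big_split /=.
  by apply: eq_bigr => w _; rewrite /edge_point mulrDl !mulrA.
move=> E; rewrite -(lin u v) ?mem_undup ?inE ?eqxx ?orbT //.
by rewrite -(lin u' v') ?mem_undup ?inE ?eqxx ?orbT // E.
Qed.

Lemma edge_path_lip (f : G -> R) u v l :
  (forall a b, adj a b -> `|f a - f b| <= 1) ->
  edge_path (vpt u) (vpt v) l -> `|f u - f v| <= l.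
Proof.
move=> flip uv.
suff : forall x y k, edge_path x y k -> forall a b s a' b' t,
    val x = edge_point a b s -> val y = edge_point a' b' t ->
    `|((1 - s) * f a + s * f b) - ((1 - t) * f a' + t * f b')| <= k.
  move/(_ _ _ _ uv u u 0 v v 0); rewrite !edge_point0 => /(_ erefl erefl).
  by rewrite !subr0 !mul1r !mul0r !addr0.
move=> x y k.
elim=> [w|{}x {}y z a b s t {}k ab s01 t01 xE yE _ IH] a1 b1 s1 a2 b2 t1.
  by move=> -> /(edge_point_interp f) ->; rewrite subrr normr0.
move=> x1 z1; have := IH _ _ _ _ _ _ yE z1.
rewrite xE in x1; rewrite -(edge_point_interp f x1).
have := ler_distD ((1 - t) * f a + t * f b) ((1 - s) * f a + s * f b)
  ((1 - t1) * f a2 + t1 * f b2).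
have -> : (1 - s) * f a + s * f b - ((1 - t) * f a + t * f b) =
  (s - t) * (f b - f a) by ring.
have : `|(s - t) * (f b - f a)| <= `|s - t|.
  by rewrite normrM ler_piMr // distrC flip.
lra.
Qed.

Lemma edge_path_walk n u v : walk n u v -> edge_path (vpt u) (vpt v) n%:R.
Proof.
elim: n u => [|n IH] u; first by move=> /= ->; apply: edge_path_nil.
case=> w uw /IH wv; rewrite -add1n natrD; apply: edge_path_cat wv.
have -> : 1%:R = `|0 - 1 : R| by rewrite sub0r normrN normr1.
by apply: edge_path_seg uw _ _ _ _; rewrite ?edge_point0 ?edge_point1 ?lexx ?ler01.
Qed.

Lemma joined_vpt u v : linked u v -> joined (vpt u) (vpt v).
Proof. by case=> n /edge_path_walk; exists n%:R. Qed.

Lemma gdist_vpt u v : linked u v -> gdist (vpt u) (vpt v) = (dist u v)%:R.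
Proof.
move=> uv; apply/eqP; rewrite eq_le gdist_le; last exact/edge_path_walk/walk_dist.
rewrite leNgt; apply/negP => /(gdist_lt (joined_vpt uv))[l uvl].
apply/negP; rewrite -leNgt.
have := @edge_path_lip (fun w => (dist u w)%:R) _ _ _ _ uvl.
rewrite dist_refl sub0r normrN ger0_norm //; apply=> a b ab.
have [ua|nua] := pselect (linked u a); last first.
  have nub : ~ linked u b.
    by move=> ub; apply: nua; apply: linked_trans ub _; exists 1%N; exists a => //;
       exact: adj_sym.
  have dist0 w : ~ linked u w -> dist u w = 0%N.
    move=> nuw; rewrite /dist xgetPN // => n [uwn _].
    by apply: nuw; exists n.
  by rewrite !dist0 // subrr normr0 ler01.
have lab : linked a b by exists 1%N; apply: walk_adj.
have ub := linked_trans ua lab.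
have := dist_trans ua lab; have := dist_trans ub (linked_sym lab).
have := dist_le (walk_adj ab); have := dist_le (walk_adj (adj_sym ab)).
move=> d1 d2 d3 d4.
have le1 : (dist u a <= dist u b + 1)%N by apply: leq_trans d3 _; rewrite leq_add2l.
have le2 : (dist u b <= dist u a + 1)%N by apply: leq_trans d4 _; rewrite leq_add2l.
by move: le1 le2; rewrite -!(ler_nat R) !natrD ler_distl; lra.
Qed.

Lemma near_vertex x : exists u, joined x (vpt u) /\ gdist x (vpt u) <= 1.
Proof.
suff [u [l xu l1]] : exists u, exists2 l, edge_path x (vpt u) l & l <= 1.
  by exists u; split; [exists l|apply: le_trans (gdist_le xu) l1].
have := set_mem (valP x); case=> [[u xE]|[u [v [t [uv t01 xE]]]]].
  exists u, 0 => //; have -> : x = vpt u by apply: val_inj.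
  exact: edge_path_nil.
exists u, `|t - 0|; last by rewrite subr0 ger0_norm; case/andP: t01.
by apply: edge_path_seg uv t01 _ xE _; rewrite ?edge_point0 // lexx ler01.
Qed.

Lemma walk_seq n u v : walk n u v -> exists w : nat -> G,
  [/\ w 0%N = u, w n = v & forall i, (i < n)%N -> adj (w i) (w i.+1)].
Proof.
elim: n u => [|n IH] u; first by move=> /= <-; exists (fun=> u).
case=> u1 uu1 /IH[w [w0 wn wadj]]; exists (fun i => if i is j.+1 then w j else u).
by split=> // -[|i]; [rewrite w0|apply: wadj].
Qed.

Lemma walk_seq2 m n u p v : walk m u p -> walk n p v -> exists w : nat -> G,
  [/\ w 0%N = u, w m = p, w (m + n)%N = v &
      forall i, (i < m + n)%N -> adj (w i) (w i.+1)].
Proof.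
elim: m u => [|m IH] u; first by move=> /= -> /walk_seq[w [w0 wn wadj]]; exists w.
case=> u1 uu1 /IH{}IH /IH[w [w0 wm wn wadj]].
exists (fun i => if i is j.+1 then w j else u).
by split=> // -[|i]; [rewrite w0|apply: wadj].
Qed.

Lemma seq_path (w : nat -> G) n : (forall i, (i < n)%N -> adj (w i) (w i.+1)) ->
  exists g : R -> point, (forall i, (i <= n)%N -> g i%:R = vpt (w i)) /\
    forall s t, 0 <= s -> s <= t -> t <= n%:R -> edge_path (g s) (g t) (t - s).
Proof.
elim: n => [|n IH] wadj.
  exists (fun=> vpt (w 0%N)); split=> [[]//|s t s0 st t0].
  have -> : t - s = 0 by lra.
  exact: edge_path_nil.
have [|g [gw gpath]] := IH; first by move=> i /ltnW; apply: wadj.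
have adjn := wadj n (ltnSn n).
pose h s := if s <= n%:R then g s else ept (w n) (w n.+1) (s - n%:R).
have hpath s t : n%:R <= s -> s <= t -> t <= n.+1%:R ->
    edge_path (h s) (h t) (t - s).
  rewrite -natr1 => ns st tn.
  have hE r : n%:R <= r -> r <= n%:R + 1 ->
      val (h r) = edge_point (w n) (w n.+1) (r - n%:R).
    move=> nr rn; rewrite /h; case: ifPn => [rn'|_].
      have -> : r = n%:R by lra.
      by rewrite gw // subrr edge_point0.
    by rewrite val_ept //; lra.
  have -> : t - s = `|(s - n%:R) - (t - n%:R)| by rewrite ler0_norm; lra.
  by apply: edge_path_seg adjn _ _ (hE _ _ _) (hE _ _ _); lra.
have hn : h n%:R = vpt (w n) by rewrite /h lexx gw.
exists h; split.
  move=> i; rewrite leq_eqVlt => /orP[/eqP ->|]; last first.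
    by rewrite ltnS => lein; rewrite /h ler_nat lein gw.
  have nE : n.+1%:R - n%:R = 1 :> R by rewrite -natr1 addrAC subrr add0r.
  rewrite /h ler_nat ltnn nE; apply: val_inj.
  by rewrite val_ept ?edge_point1 // lexx ler01.
move=> s t s0 st tn; have [nt|tn'] := leP t n%:R.
  by rewrite /h nt (le_trans st nt); apply: gpath.
have [sn|ns] := leP s n%:R; last by apply: hpath => //; apply: ltW.
have -> : t - s = (n%:R - s) + (t - n%:R) by ring.
apply: edge_path_cat (hpath _ _ (lexx _) (ltW tn') tn).
by rewrite {1}/h sn hn -(gw n) //; apply: gpath.
Qed.

Lemma geodesic_through u v p : linked u p -> linked p v ->
  (dist u p + dist p v = dist u v)%N ->
  exists2 S, geodesic (@graph_dist R G) (vpt u) (vpt v) S & S (vpt p).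
Proof.
move=> up pv upv.
have [w [w0 wp wv wadj]] := walk_seq2 (walk_dist up) (walk_dist pv).
have [g [gw gpath]] := seq_path wadj; rewrite upv in wv wadj gw gpath.
have g0 : g 0 = vpt u by rewrite -w0; apply: gw 0%N _.
have gv : g (dist u v)%:R = vpt v by rewrite gw ?wv.
exists (g @` `[0, (dist u v)%:R]); last first.
  exists (dist u p)%:R; last by rewrite gw ?wp // -upv leq_addr.
  by rewrite /= in_itv /= ler0n ler_nat -upv leq_addr.
exists (dist u v)%:R, g; split=> //.
have iso s t : 0 <= s -> s <= t -> t <= (dist u v)%:R ->
    graph_dist (g s) (g t) = (t - s)%:E.
  move=> s0 st tn; have stp := gpath s t s0 st tn.
  have st_j : joined (g s) (g t) by exists (t - s).
  rewrite graph_distE //; congr _%:E; apply/eqP; rewrite eq_le gdist_le //=.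
  have p1 := gpath 0 s (lexx 0) s0 (le_trans st tn).
  have p2 := gpath t _ (le_trans s0 st) tn (lexx _).
  have j1 : joined (g 0) (g s) by exists (s - 0).
  have j2 : joined (g t) (g (dist u v)%:R) by exists ((dist u v)%:R - t).
  have := gdist_trans j1 (joined_trans st_j j2); have := gdist_trans st_j j2.
  have := gdist_le p1; have := gdist_le p2.
  have : gdist (g 0) (g (dist u v)%:R) = (dist u v)%:R.
    by rewrite g0 gv gdist_vpt //; apply: linked_trans up pv.
  lra.
move=> s t; rewrite !in_itv /= => /andP[s0 sn] /andP[t0 tn].
have [st|/ltW ts] := leP s t.
  by rewrite iso // ler0_norm ?opprB // subr_le0.
rewrite graph_distE; last by apply: joined_sym; exists (s - t); apply: gpath.
rewrite gdist_sym -graph_distE; last by exists (s - t); apply: gpath.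
by rewrite iso // ger0_norm // subr_ge0.
Qed.

Lemma geodesic_between x y S z : geodesic (@graph_dist R G) x y S -> S z ->
  [/\ joined x z, joined z y & gdist x z + gdist z y = gdist x y].
Proof.
case=> L [g [L0 g0 gL iso ->]] [t]; rewrite /= in_itv /= => /andP[t0 tL] <-.
have m0 : 0 \in `[0, L] by rewrite in_itv /= lexx.
have mL : L \in `[0, L] by rewrite in_itv /= lexx andbT.
have mt : t \in `[0, L] by rewrite in_itv /= t0.
have d1 := iso _ _ m0 mt; have d2 := iso _ _ mt mL; have d3 := iso _ _ m0 mL.
rewrite g0 in d1 d3; rewrite gL in d2 d3.
split; [exact: graph_dist_joined d1|exact: graph_dist_joined d2|].
by rewrite /gdist d1 d2 d3 /= !ler0_norm; lra.
Qed.

End Realization.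

Section Hyperbolicity.
Variables (R : realType) (G : graph).
Local Notation point := (set_type (@realization R G)).
Local Notation gdist := (@gdist R G).
Local Notation vpt := (@vpt R G).
Implicit Types (u v a b p : G) (x y z q : point).

Lemma hyperbolic_fellow : hyperbolic R G -> exists c, fellow G c.
Proof.
rewrite /hyperbolic => hyp.
have [M M0 hypM] : exists2 M : R, 0 <= M & (delta_graph R G <= M%:E)%E.
  case: (delta_graph R G) hyp => [r|//|] _; last by exists 0; rewrite ?leNye.
  by exists `|r|; rewrite ?normr_ge0 // lee_fin ler_norm.
exists (Num.truncn (2 * (M + 1))).+1 => u v w p up pv pw upv.
have uv := linked_trans up pv; have uw := linked_trans up pw.
have vw := linked_trans (linked_sym uv) uw.
have puv : (dist u p + dist p v = dist u v)%N.
  by apply/eqP; rewrite eqn_leq dist_trans // andbT -[leqRHS]addn0.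
have [S1 g1 S1p] := geodesic_through R up pv puv.
have [S2 g2 _] := @geodesic_through R G v w w vw (linked_refl w)
  ltac:(by rewrite dist_refl addn0).
have [S3 g3 _] := @geodesic_through R G w u u (linked_sym uw) (linked_refl u)
  ltac:(by rewrite dist_refl addn0).
have lt_delta : (delta_triangle (@graph_dist R G) S1 S2 S3 < (M + 1)%:E)%E.
  apply: (@le_lt_trans _ _ M%:E); last by rewrite lte_fin; lra.
  apply: le_trans hypM.
  apply: (@le_trans _ _ (delta_on (@graph_dist R G) (component (vpt u)))).
    apply: ereal_sup_ubound; exists S1, S2, S3; split=> //.
    - by move=> x /(geodesic_between g1)[].
    - by move=> x /(geodesic_between g2)[? _ _]; apply: joined_trans (joined_vpt R uv) _.
    - by move=> x /(geodesic_between g3)[? _ _]; apply: joined_trans (joined_vpt R uw) _.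
    - by exists (vpt u), (vpt v), (vpt w); split.
  by apply: ereal_sup_ubound; exists (vpt u).
have [_ [delta [delta0 [thin1 _ _]] <-]] := ereal_inf_lt lt_delta.
rewrite lte_fin => deltaM.
have [q S23q] := thin1 _ S1p.
have [pq pqE] : joined (vpt p) q /\ graph_dist (vpt p) q = (gdist (vpt p) q)%:E.
  have pq : joined (vpt p) q.
    case: S23q => [/(geodesic_between g2)|/(geodesic_between g3)] [jq _ _].
      by apply: joined_trans jq; apply: joined_vpt.
    by apply: joined_trans jq; apply: joined_vpt.
  by split=> //; apply: graph_distE.
rewrite pqE lee_fin => pq_delta.
have near a b : linked p a -> linked p b ->
    joined (vpt a) q -> joined q (vpt b) ->
    gdist (vpt a) q + gdist q (vpt b) = gdist (vpt a) (vpt b) ->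
    btw (Num.truncn (2 * (M + 1))).+1 a p b.
  move=> pa pb aq qb aqb; have ap := linked_sym pa.
  rewrite /btw -(ler_nat R) !natrD -!(gdist_vpt R) //; last exact: linked_trans ap pb.
  have := gdist_trans aq (joined_sym pq); have := gdist_trans pq qb.
  rewrite (gdist_sym q (vpt p)).
  have := truncnS_gt (2 * (M + 1)); lra.
case: S23q => [/(geodesic_between g2)|/(geodesic_between g3)] [jq1 jq2 dq].
  right; apply: near => //; try exact: joined_sym.
  by rewrite gdist_sym addrC gdist_sym dq gdist_sym.
left; apply: near => //; try exact: joined_sym; first exact: linked_sym.
by rewrite gdist_sym addrC gdist_sym dq gdist_sym.
Qed.

Lemma bounded_graph_dist n : graph_connected G ->
  (forall u v, (dist u v <= n)%N) -> bounded_graph R G.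
Proof.
move=> conn distn; apply: (@le_lt_trans _ _ (n%:R + 2)%:E); last exact: ltry.
apply: ge_ereal_sup => _ [x [y ->]].
have [u [xu xu1]] := near_vertex x; have [v [yv yv1]] := near_vertex y.
have uv := joined_vpt R (graph_linked conn u v).
have xv := joined_trans xu uv; have vy := joined_sym yv.
rewrite graph_distE ?lee_fin; last exact: joined_trans xv vy.
have := gdist_trans xv vy; have := gdist_trans xu uv.
rewrite (gdist_vpt R (graph_linked conn u v)) (gdist_sym (vpt v)).
by have := distn u v; rewrite -(ler_nat R); lra.
Qed.

Hypothesis conn : graph_connected G.

Lemma graph_joined x y : joined x y.
Proof.
have [u [xu _]] := near_vertex x; have [v [yv _]] := near_vertex y.
apply: joined_trans xu (joined_trans (joined_vpt R (graph_linked conn u v)) _).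
exact: joined_sym.
Qed.

Let tri x y z : gdist x z <= gdist x y + gdist y z.
Proof. by apply: gdist_trans; apply: graph_joined. Qed.

Lemma gdist_fellow c x y z q : fellow G c ->
  gdist x q + gdist q y = gdist x y ->
  gdist x q + gdist q z <= gdist x z + (3 * c + 18)%:R \/
  gdist z q + gdist q y <= gdist z y + (3 * c + 18)%:R.
Proof.
move=> fc xqy.
have [u [_ xu]] := near_vertex x; have [v [_ yv]] := near_vertex y.
have [w [_ zw]] := near_vertex z; have [p [_ qp]] := near_vertex q.
have gl a b := graph_linked conn a b.
have E a b : (dist a b)%:R = gdist (vpt a) (vpt b) by rewrite gdist_vpt.
have approx x1 y1 a b : gdist x1 (vpt a) <= 1 -> gdist y1 (vpt b) <= 1 ->
    (dist a b)%:R <= gdist x1 y1 + 2 /\ gdist x1 y1 <= (dist a b)%:R + 2.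
  move=> xa yb; rewrite E; have := tri x1 (vpt a) y1.
  have := tri (vpt a) (vpt b) y1; have := tri (vpt a) x1 (vpt b).
  have := tri x1 y1 (vpt b); rewrite (gdist_sym (vpt a) x1) (gdist_sym (vpt b) y1).
  by split; lra.
have [xq1 xq2] := approx _ _ _ _ xu qp; have [qy1 qy2] := approx _ _ _ _ qp yv.
have [xy1 xy2] := approx _ _ _ _ xu yv; have [qz1 qz2] := approx _ _ _ _ qp zw.
have [xz1 xz2] := approx _ _ _ _ xu zw; have [zq1 zq2] := approx _ _ _ _ zw qp.
have [zy1 zy2] := approx _ _ _ _ zw yv.
have slack : btw 6 u p v by rewrite /btw -(ler_nat R) !natrD; lra.
have := fellow_slack fc (gl _ _) (gl _ _) (gl p w) slack.
rewrite /btw -!(ler_nat R) !natrD !natrM.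
by case=> H; [left|right]; lra.
Qed.

Lemma geodesic_fellow c x y S q : fellow G c ->
  geodesic (@graph_dist R G) x y S ->
  gdist x q + gdist q y <= gdist x y + (3 * c + 18)%:R ->
  exists2 r, S r & gdist q r <= 2 * (3 * c + 18)%:R.
Proof.
move=> fc gS xqy; set K := (3 * c + 18)%:R in xqy *.
have K0 : 0 <= K by apply: ler0n.
have [xq0 qy0] : 0 <= gdist x q /\ 0 <= gdist q y by split; apply: gdist_ge0.
have [r Sr xr] : exists2 r, S r & gdist x r = Num.min (gdist x q) (gdist x y).
  case: gS => L [g [L0 g0 gL iso ->]].
  have m0 : 0 \in `[0, L] by rewrite in_itv /= lexx.
  have mL : L \in `[0, L] by rewrite in_itv /= lexx andbT.
  have xyL : gdist x y = L.
    by rewrite /gdist -g0 -gL iso //= sub0r normrN ger0_norm.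
  pose t := Num.min (gdist x q) (gdist x y).
  have mt : t \in `[0, L].
    by rewrite in_itv /t xyL /= le_min xq0 L0 ge_min lexx orbT.
  have t0 : 0 <= t by move: mt; rewrite in_itv => /andP[].
  exists (g t); first by exists t.
  by rewrite /gdist -{1}g0 iso //= sub0r normrN ger0_norm.
exists r => //; have [_ _ xry] := geodesic_between gS Sr.
have ry0 : 0 <= gdist r y by apply: gdist_ge0.
have := tri q y r; rewrite (gdist_sym y r).
have := gdist_fellow q fc xry; rewrite -/K (gdist_sym r q).
move: xr; have [lt_xq|le_xq] := ltP (gdist x q) (gdist x y) => xr; last lra.
by case; lra.
Qed.

Lemma fellow_hyperbolic c : fellow G c -> hyperbolic R G.
Proof.
move=> fc; set K : R := (3 * c + 18)%:R; pose C := 2 * K.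
have C0 : 0 <= C by apply: mulr_ge0 => //; apply: ler0n.
apply: (@le_lt_trans _ _ C%:E); last exact: ltry.
apply: ge_ereal_sup => _ [x0 _ <-].
apply: ge_ereal_sup => _ [S1 [S2 [S3 [_ _ _ [x [y [z [g1 g2 g3]]]] ->]]]].
apply: ereal_inf_lbound; exists C => //; split=> //.
have side x1 y1 z1 T1 T2 T3 : geodesic (@graph_dist R G) x1 y1 T1 ->
    geodesic (@graph_dist R G) y1 z1 T2 -> geodesic (@graph_dist R G) z1 x1 T3 ->
    T1 `<=` neighborhood (@graph_dist R G) C (T2 `|` T3).
  move=> h1 h2 h3 q /(geodesic_between h1)[_ _ qE].
  have [H|H] := gdist_fellow z1 fc qE.
    have [|r T3r qr] := geodesic_fellow (q := q) fc h3.
      by move: H; rewrite (gdist_sym x1 q) (gdist_sym q z1) (gdist_sym x1 z1) addrC.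
    by exists r; [right|rewrite (graph_distE (graph_joined q r)) lee_fin].
  have [|r T2r qr] := geodesic_fellow (q := q) fc h2.
    by move: H; rewrite (gdist_sym z1 q) (gdist_sym q y1) (gdist_sym z1 y1) addrC.
  by exists r; [left|rewrite (graph_distE (graph_joined q r)) lee_fin].
by split; [apply: side g1 g2 g3|apply: side g2 g3 g1|apply: side g3 g1 g2].
Qed.

End Hyperbolicity.

Section Factors.
Variables G1 G2 : graph.
Hypotheses (conn1 : graph_connected G1) (conn2 : graph_connected G2).

Lemma fellow_factor1 c : (exists v0 v1 : G2, adj v0 v1) ->
  fellow (direct_product G1 G2) c -> fellow G1 (170 * c + 2).
Proof.
case=> v0 [v1 v01].
apply: (@fellow_lift _ _ (fun a : direct_product G1 G2 => a.1)
  (fun b u => (u, if b then v1 else v0) : direct_product G1 G2)) => //.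
  by move=> a b [].
by move=> [] u v uv; split=> //=; apply: adj_sym.
Qed.

Lemma fellow_factor2 c : (exists u0 u1 : G1, adj u0 u1) ->
  fellow (direct_product G1 G2) c -> fellow G2 (170 * c + 2).
Proof.
case=> u0 [u1 u01].
apply: (@fellow_lift _ _ (fun a : direct_product G1 G2 => a.2)
  (fun b v => (if b then u1 else u0, v) : direct_product G1 G2)) => //.
  by move=> a b [].
by move=> [] u v uv; split=> //=; apply: adj_sym.
Qed.

End Factors.

Theorem theorem2p25 (R : realType) (G1 G2 : graph)
  (ne1 : inhabited G1) (ne2 : inhabited G2)
  (conn1 : graph_connected G1) (conn2 : graph_connected G2)
  (nontriv1 : ~ trivial_graph G1) (nontriv2 : ~ trivial_graph G2)
  (hyp : hyperbolic R (direct_product G1 G2)) :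
  (hyperbolic R G1 /\ bounded_graph R G2) \/
  (hyperbolic R G2 /\ bounded_graph R G1).
Proof.
have [c fP] := hyperbolic_fellow hyp.
have f1 := fellow_factor1 conn1 (graph_edge conn2 ne2 nontriv2) fP.
have f2 := fellow_factor2 conn2 (graph_edge conn1 ne1 nontriv1) fP.
have [b1|b2] := product_fellow_bounded conn1 conn2 fP; [right|left].
  split; first exact: fellow_hyperbolic f2.
  by apply: bounded_graph_dist => // u v; apply/ltnW/b1.
split; first exact: fellow_hyperbolic f1.
by apply: bounded_graph_dist => // u v; apply/ltnW/b2.
Qed.
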